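(* Let $G$ be a simple graph with vertex set $[d]$ and let $\chi_G$ be its chromatic polynomial. Define the polynomial $W_G(t)$ by $$\sum_{n\ge 0}\chi_G(n)t^n=\frac{W_G(t)}{(1-t)^{d+1}}.$$ Then $$W_G(t)=\sum_{\pi\in\mathcal S_d}t^{c(\pi)},$$ where $c(\pi)$ is the number of cuts of $\pi$ with respect to $G$. In particular, $\sum_{\pi\in\mathcal S_d}t^{c(\pi)}$ is independent of the labeling of the vertices of $G$ by $[d]$.
   Context: $G$ is a simple graph (no loops, no multiple edges) with vertex set $[d]$. An $n$-coloring of $G$ is a map $\phi:[d]\to[n]$ (not necessarily surjective) with $\phi(x)\ne\phi(y)$ whenever $x,y$ are adjacent; $\chi_G(n)$ is the number of $n$-colorings. A path of length $r$ in $G$ is a sequence of vertices $v_0,\dots,v_r$ with consecutive vertices adjacent. For $\pi=a_1a_2\cdots a_d\in\mathcal S_d$ and $k\in[d]$, $\ell(k)$ is the largest $r\ge0$ such that there are indices $i_0<i_1<\cdots<i_r=k$ with $a_{i_0},\dots,a_{i_r}$ a path in $G$. An integer $k\in\{0,1,\dots,d-1\}$ is a cut of $\pi$ if $k=0$, or $\ell(k)<\ell(k+1)$, or $\ell(k)=\ell(k+1)$ and $a_k<a_{k+1}$. $c(\pi)$ is the number of cuts (so $0$ is always counted). *)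

(* Defs.v *)
From HB Require Import structures.
From mathcomp Require Import all_boot all_order all_fingroup all_algebra.

Set Implicit Arguments.
Unset Strict Implicit.
Unset Printing Implicit Defensive.

Import GRing.Theory.

(* A simple graph on the vertex set [d] is a symmetric irreflexive
   [e : rel 'I_d]; vertices and positions are numbered 0, ..., d-1 instead of
   1, ..., d. *)

Section PowerSeries.

Local Open Scope ring_scope.

Variable R : comNzRingType.

(* The formal power series \sum_n (F n) t^n is encoded by F : nat -> R. *)
Definition fps_mul (F G : nat -> R) (n : nat) : R :=
  \sum_(i < n.+1) F i * G (n - i)%N.

Definition fps_of_poly (p : {poly R}) (n : nat) : R := p`_n.

(* F = P / Q in R[[t]], meaningful when Q(0) is a unit: then Q is invertible
   in R[[t]], so F is determined by P and Q. *)
Definition fps_is_frac (F : nat -> R) (P Q : {poly R}) : Prop :=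
  fps_mul F (fps_of_poly Q) =1 fps_of_poly P.

End PowerSeries.

Section Graph.

Variables (d : nat) (e : rel 'I_d).

Definition proper_coloring (n : nat) (phi : {ffun 'I_d -> 'I_n}) : bool :=
  [forall x, forall y, e x y ==> (phi x != phi y)].

(* The value at n of the chromatic polynomial. *)
Definition chi (n : nat) : nat :=
  #|[set phi : {ffun 'I_d -> 'I_n} | proper_coloring phi]|.

Definition fps_chi (n : nat) : int := Posz (chi n).

(* W(t) is the numerator in \sum_n chi(n) t^n = W(t) / (1 - t)^(d+1). *)
Definition is_W (W : {poly int}) : Prop :=
  fps_is_frac fps_chi W ((1 - 'X) ^+ d.+1)%R.

(* There are positions i_0 < ... < i_r = k such that the vertices
   pi i_0, ..., pi i_r form a path of length r. *)
Definition has_path_ending_at (pi : 'S_d) (k : 'I_d) (r : nat) : bool :=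
  [exists i : r.+1.-tuple 'I_d,
    [&& sorted (fun p q : 'I_d => p < q) i,
        tnth i ord_max == k
      & sorted e [seq pi p | p <- i]]].

(* Restricting to r < d loses nothing: r + 1 distinct positions are used. *)
Definition ell (pi : 'S_d) (k : 'I_d) : nat :=
  \max_(r < d | has_path_ending_at pi k r) r.

(* The candidate cut k in {0, ..., d-1} sits just before the 0-based position
   k, so a_k and a_(k+1) in 1-based notation are pi j, where j + 1 = k, and
   pi k. *)
Definition is_cut (pi : 'S_d) (k : 'I_d) : bool :=
  (k == 0 :> nat) ||
  [exists j : 'I_d, (j.+1 == k :> nat) &&
    ((ell pi j < ell pi k) || (ell pi j == ell pi k) && (pi j < pi k))].

Definition num_cuts (pi : 'S_d) : nat := #|[set k : 'I_d | is_cut pi k]|.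

Definition cut_poly : {poly int} := (\sum_(pi : 'S_d) 'X^(num_cuts pi))%R.

End Graph.

(* The vertex labelled v by e is labelled s^-1 v by [relabel s e]. *)
Definition relabel (d : nat) (s : 'S_d) (e : rel 'I_d) : rel 'I_d :=
  fun x y => e (s x) (s y).

(* Main.v *)
(* Call a coloring phi compatible with a permutation pi if phi (pi 0),
   phi (pi 1), ... is weakly increasing, and strictly so at each cut. Along an
   edge between positions i < j, ell increases, so there is a cut in between;
   hence phi is proper and orients the edges as pi does, so that ell can be read
   off phi alone. Therefore pi must list the vertices by increasing color, ties
   broken by decreasing (ell, label): each proper coloring is compatible with
   exactly one permutation. As pi is compatible with C(n + d - c(pi), d)
   colorings, chi(n) is the sum of these numbers, and
   \sum_n C(n + d - c, d) t^n = t^c / (1 - t)^(d+1). *)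

Require Import Defs.
From HB Require Import structures.
From mathcomp Require Import all_boot all_order all_fingroup all_algebra.
From mathcomp Require Import zify.

Set Implicit Arguments.
Unset Strict Implicit.
Unset Printing Implicit Defensive.

Import GRing.Theory.

(** * Power series of the form t^c / (1 - t)^(m+1) *)

Section PowerSeriesLemmas.

Local Open Scope ring_scope.

Variable R : comNzRingType.

(** Coefficient n only involves F up to n, so F may be truncated to a polynomial, which makes
    polynomial algebra available. *)
Lemma fps_mulE (F : nat -> R) (P : {poly R}) n :
  fps_mul F (fps_of_poly P) n = (\poly_(i < n.+1) F i * P)`_n.
Proof.
by rewrite coefM; apply: eq_bigr => i _; rewrite coef_poly ltn_ord.
Qed.

Lemma fps_mul1 (F : nat -> R) : fps_mul F (fps_of_poly 1) =1 F.
Proof. by move=> n; rewrite fps_mulE mulr1 coef_poly ltnSn. Qed.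

Lemma eq_fps_mul (F F' G : nat -> R) : F =1 F' -> fps_mul F G =1 fps_mul F' G.
Proof. by move=> FF' n; apply: eq_bigr => i _; rewrite FF'. Qed.

Lemma fps_mul_suml (I : finType) (F : I -> nat -> R) (G : nat -> R) n :
  fps_mul (fun k => \sum_i F i k) G n = \sum_i fps_mul (F i) G n.
Proof.
by rewrite exchange_big; apply: eq_bigr => k _; rewrite mulr_suml.
Qed.

(** The coefficients of (1 - t) F(t). *)
Definition fps_delta (F : nat -> R) (n : nat) : R :=
  F n - (if n is k.+1 then F k else 0).

Lemma fps_mul_1subX (F : nat -> R) (P : {poly R}) :
  fps_mul F (fps_of_poly ((1 - 'X) * P))
  =1 fps_mul (fps_delta F) (fps_of_poly P).
Proof.
move=> n; rewrite fps_mulE mulrA coefM; apply: eq_bigr => i _; congr (_ * _).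
rewrite mulrBr mulr1 coefB coefMX !coef_poly ltn_ord /fps_delta.
by case: i => [[|i] lt_i] //=; rewrite (ltnW lt_i).
Qed.

(** The coefficients of t^c / (1 - t)^(m+1). *)
Definition shifted_binomial (c m n : nat) : R :=
  if (c <= n)%N then ('C(n - c + m, m))%:R else 0.

(** Pascal's rule, with the boundary cases n < c and n = c apart. *)
Lemma fps_delta_shifted_binomial c m :
  fps_delta (shifted_binomial c m.+1) =1 shifted_binomial c m.
Proof.
move=> n; rewrite /fps_delta /shifted_binomial.
case: n => [|n].
  by rewrite leqn0 subr0; case: eqP => // ->; rewrite !binn.
rewrite -(ltnS c n); case: ltngtP => [lt_cn | | ->]; last 2 first.
- by rewrite subr0.
- by rewrite subnn !add0n !binn subr0.
by rewrite subSn // !addSn addnS binS natrD addrC addKr.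
Qed.

(** Each factor 1 - t lowers m by one. At m = 0 the series is the indicator of n >= c, whose
    difference is concentrated at c. *)
Lemma fps_mul_shifted_binomial c m :
  fps_mul (shifted_binomial c m) (fps_of_poly ((1 - 'X) ^+ m.+1))
  =1 fps_of_poly 'X^c.
Proof.
elim: m => [|m IHm] n; last first.
  rewrite exprS fps_mul_1subX -IHm.
  exact/eq_fps_mul/fps_delta_shifted_binomial.
rewrite expr1 -[1 - 'X]mulr1 fps_mul_1subX fps_mul1 /fps_of_poly coefXn.
rewrite /fps_delta /shifted_binomial; case: n => [|n].
  by rewrite leqn0 eq_sym bin0 subr0; case: eqP.
by rewrite !bin0 -(ltnS c n); case: ltngtP; rewrite ?subrr ?subr0.
Qed.

End PowerSeriesLemmas.

(** For n < c the upper index n + (d - c) is below d, so the binomial vanishes in accordance with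
    the default value 0. *)
Lemma binomial_shiftE d c n : (c <= d)%N ->
  Posz 'C(n + (d - c), d) = shifted_binomial int c d n.
Proof.
move=> le_cd; rewrite /shifted_binomial; case: leqP => [le_cn | lt_nc].
  by rewrite natz; congr (Posz 'C(_, _)); lia.
by rewrite bin_small //; lia.
Qed.

(** Induction on the gap between i and j. It extends conditions on neighbouring positions to all
    pairs, once they are phrased as a transitive relation. *)
Lemma ord_consecutive d (T : rel 'I_d) : transitive T ->
  (forall i j : 'I_d, j = i.+1 :> nat -> T i j) ->
  forall i j : 'I_d, i < j -> T i j.
Proof.
move=> T_trans T_next i j lt_ij.
have [m] : exists m, j = (i + m).+1 :> nat by exists (j - i.+1); lia.
elim: m j {lt_ij} => [|m IHm] j jE; first by apply: T_next; rewrite jE addn0.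
have lt_d : (i + m).+1 < d by have := ltn_ord j; lia.
apply: (T_trans (Ordinal lt_d)); first exact: IHm.
by apply: T_next; rewrite jE /= addnS.
Qed.

(** * Counting weakly increasing maps with prescribed strict steps *)

Section Monotone.

Variables (d n : nat) (S : pred 'I_d).
Hypothesis S0 : forall k : 'I_d, k = 0 :> nat -> S k.

Definition strict_at (f : {ffun 'I_d -> 'I_n}) : bool :=
  [forall i : 'I_d, forall j : 'I_d, (j == i.+1 :> nat) ==>
     (f i <= f j) && (S j ==> (f i < f j))].

Let h (i : 'I_d) : nat := #|[set k : 'I_d | ~~ S k & k <= i]|.
Let N := #|[set k | ~~ S k]|.

Let hS (i j : 'I_d) : j = i.+1 :> nat -> h j = ~~ S j + h i.
Proof.
move=> ij; rewrite /h (cardsD1 j) inE leqnn andbT; congr (_ + _).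
by apply: eq_card => k; rewrite !inE -val_eqE /=; case: (S k) => /=; lia.
Qed.

Let h_le i : h i <= N.
Proof. by apply/subset_leq_card/subsetP => k; rewrite !inE => /andP[]. Qed.

Let h_first (i : 'I_d) : i = 0 :> nat -> h i = 0.
Proof.
move=> i0; apply: eq_card0 => k; rewrite !inE i0 leqn0.
by apply/negbTE/negP => /andP[/negP Sk /eqP /S0].
Qed.

Let h_last (i : 'I_d) : i.+1 = d -> h i = N.
Proof.
move=> id; apply: eq_card => k; rewrite !inE.
by rewrite -ltnS id ltn_ord andbT.
Qed.

Let shift_lt (f : {ffun 'I_d -> 'I_n}) i : f i + h i < n + N.
Proof. by rewrite -addSn leq_add. Qed.

Let shift (f : {ffun 'I_d -> 'I_n}) : d.-tuple 'I_(n + N) :=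
  [tuple Ordinal (shift_lt f i) | i < d].

Let sorted_tupleP (t : d.-tuple 'I_(n + N)) :
  reflect (forall i j : 'I_d, j = i.+1 :> nat -> tnth t i < tnth t j)
    (sorted ltn [seq val x | x <- t]).
Proof.
have nthE (i : 'I_d) : nth 0 [seq val x | x <- t] i = tnth t i.
  by rewrite (nth_map (tnth t i)) ?size_tuple // -tnth_nth.
apply: (iffP (sortedP 0)); rewrite size_map size_tuple => sorted_t.
  by move=> i j ij; rewrite -!nthE ij; apply: sorted_t; rewrite -ij.
move=> i lt_i; have /= := sorted_t (Ordinal (ltnW lt_i)) (Ordinal lt_i) erefl.
by rewrite -!nthE.
Qed.

Let shift_inj : injective shift.
Proof.
move=> f g fg; apply/ffunP => i; apply/val_inj => /=.
by have /(congr1 val)/= := congr1 (fun t => tnth t i) fg;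
   rewrite !tnth_mktuple /= => /addIn.
Qed.

(* Adding to f i the number h i of indices k <= i where f may stay constant
   makes f strictly increasing. *)
Lemma card_strict_at : #|[set f | strict_at f]| = 'C(n + N, d).
Proof.
rewrite -card_ltn_sorted_tuples -(card_imset _ shift_inj).
apply: eq_card => t; rewrite inE; apply/imsetP/idP => [[f] | /sorted_tupleP t_lt].
  rewrite inE => /forallP f_S ->; apply/sorted_tupleP => i j ij.
  have := f_S i => /forallP/(_ j); rewrite ij eqxx /=.
  by rewrite !tnth_mktuple /= (hS ij); case: (S j) => /=; lia.
(* [T] says that [t - h] is weakly increasing, written without truncated subtraction. *)
pose T := [rel i j : 'I_d | tnth t i + h j <= tnth t j + h i].
have T_trans : transitive T by move=> j i k /=; lia.
have T_next (i j : 'I_d) : j = i.+1 :> nat -> T i j.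
  by move=> ij /=; rewrite (hS ij); have := t_lt i j ij; case: (S j) => /=; lia.
have T_lt := ord_consecutive T_trans T_next.
(* Comparison with the first index, where [h] is 0 because it lies in [S]. *)
have t_ge i : h i <= tnth t i.
  have lt0d : 0 < d by apply: leq_ltn_trans (ltn_ord i).
  have [i0 | i_gt0] := posnP i; first by rewrite h_first.
  have /= := T_lt (Ordinal lt0d) i i_gt0.
  by rewrite (@h_first (Ordinal lt0d)) //; lia.
(* Comparison with the last index, where [h] is [N] and [t] is below [n + N]. *)
have t_bound i : tnth t i - h i < n.
  have lt_last : d.-1 < d by rewrite prednK // (leq_ltn_trans _ (ltn_ord i)).
  have h_N : h (Ordinal lt_last) = N by apply: h_last; rewrite /=; lia.
  have := ltn_ord (tnth t (Ordinal lt_last)).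
  have := t_ge i.
  have [i_last | i_lt] : i = Ordinal lt_last \/ i < Ordinal lt_last.
  - case: (ltngtP i (Ordinal lt_last)) => [||/val_inj]; [by right| |by left].
    by have := ltn_ord i => /=; lia.
  - by rewrite i_last h_N; lia.
  - by have /= := T_lt _ _ i_lt; rewrite h_N; lia.
exists [ffun i => Ordinal (t_bound i)]; last first.
  by apply: eq_from_tnth => i; apply/val_inj; rewrite tnth_mktuple /= ffunE /= subnK.
rewrite inE; apply/forallP => i; apply/forallP => j; apply/implyP => /eqP ij.
rewrite !ffunE /=; have := t_lt _ _ ij; have := hS ij.
by have := t_ge i; have := t_ge j; case: (S j) => /=; lia.
Qed.

End Monotone.

(** * Sorting along a strict total order *)

Section UniqueSorting.

Variables (d : nat) (R : rel 'I_d).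
Hypotheses (R_irr : irreflexive R) (R_trans : transitive R).
Hypothesis R_total : forall u v, u != v -> R u v || R v u.

(** The rank of v, the number of elements below v, is injective and so a permutation. Its inverse is
    sorted, and any sorted [pi] must send position j to the element of rank j. *)
Lemma card_sorting_perm :
  #|[set pi : 'S_d | [forall i : 'I_d, forall j : 'I_d,
      (j == i.+1 :> nat) ==> R (pi i) (pi j)]]| = 1.
Proof.
have rank_lt v : #|[set u | R u v]| < d.
  rewrite -[X in _ < X]card_ord -cardsT; apply: proper_card.
  by apply/properP; split=> //; exists v; rewrite ?inE ?R_irr.
pose rank v := Ordinal (rank_lt v).
have rank_mono u v : R u v -> rank u < rank v.
  move=> Ruv; apply: proper_card; apply/properP; split.
    by apply/subsetP => w; rewrite !inE => /R_trans/(_ Ruv).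
  by exists u; rewrite !inE ?R_irr.
have rank_inj : injective rank.
  move=> u v uv; apply/eqP/negPn/negP => /R_total/orP[] /rank_mono;
    by rewrite uv ltnn.
pose s := (perm rank_inj)^-1%g.
have rank_s i : rank (s i) = i.
  by have := permKV (perm rank_inj) i; rewrite permE.
rewrite -(cards1 s); apply: eq_card => pi; rewrite inE in_set1.
apply/idP/eqP => [/forallP pi_sorted | ->]; last first.
  apply/forallP => i; apply/forallP => j; apply/implyP => /eqP ij.
  have /R_total/orP[// | /rank_mono] : s i != s j.
    by apply/eqP => /perm_inj E; move: ij; rewrite E; lia.
  by rewrite !rank_s ij; lia.
have pi_lt (i j : 'I_d) : i < j -> R (pi i) (pi j).
  apply: (ord_consecutive (T := [rel i j | R (pi i) (pi j)])) => [k1 k2 k3|k l kl].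
    exact: R_trans.
  by have /forallP/(_ l) := pi_sorted k; rewrite kl eqxx.
suff rank_pi j : rank (pi j) = j.
  by apply/permP => i; apply: (rank_inj); rewrite rank_pi rank_s.
apply/val_inj => /=.
(* The elements below [pi j] are those listed before position j, and there are j of them. *)
have -> : [set u | R u (pi j)] = pi @: [set i : 'I_d | i < j].
  apply/setP => u; rewrite -[u](permKV pi) mem_imset ?inE; last exact: perm_inj.
  apply/idP/idP => [Ruj | /pi_lt//]; rewrite ltnNge leq_eqVlt.
  apply/negP => /orP[/eqP/val_inj E | /pi_lt /(R_trans Ruj)].
    by rewrite -E R_irr in Ruj.
  by rewrite R_irr.
rewrite (card_imset _ (@perm_inj _ pi)) -sum1dep_card.
by rewrite (big_ord_narrow (ltnW (ltn_ord j))) sum1_card card_ord.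
Qed.

End UniqueSorting.

(** * Longest paths and cuts of a permutation *)

Section Graph.

Variables (d : nat) (e : rel 'I_d).
Hypotheses (e_sym : symmetric e) (e_irr : irreflexive e).

Definition position_rel (pi : 'S_d) : rel 'I_d :=
  [rel p q : 'I_d | (p < q) && e (pi p) (pi q)].

(** Merging both conditions on the positions into one relation gives a single [path], which is easy
    to extend at its end. *)
Lemma has_path_ending_atP (pi : 'S_d) (k : 'I_d) (r : nat) :
  reflect (exists p s,
             [/\ size s = r, last p s = k & path (position_rel pi) p s])
          (has_path_ending_at e pi k r).
Proof.
have sortedE (s : seq 'I_d) : sorted (position_rel pi) s =
    sorted (fun p q : 'I_d => p < q) s && sorted e [seq pi p | p <- s].
  by rewrite sorted_map -sorted_relI.
apply: (iffP existsP) => [[t /and3P[t_lt /eqP t_last t_e]] | [p [s [sz <- ps]]]].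
  have := sortedE t; rewrite t_lt t_e.
  move: t t_last {t_lt t_e}; case/tupleP => p s.
  rewrite (tnth_nth p) /= -[X in nth _ _ X](size_tuple s) => t_last ps.
  by exists p, s; split; rewrite ?size_tuple // (last_nth p).
have sz' : size (p :: s) == r.+1 by rewrite /= sz.
exists (Tuple sz'); rewrite (tnth_nth p) /= -sz.
have := sortedE (p :: s); rewrite /= ps => /esym/andP[-> ->].
by rewrite (last_nth p) eqxx.
Qed.

(** The path of length 0 at k makes the maximum range over a nonempty set. *)
Lemma ell_attained (pi : 'S_d) k : has_path_ending_at e pi k (ell e pi k).
Proof.
have [] := @eq_bigmax_cond 'I_d (fun r => has_path_ending_at e pi k r) val.
  have d_gt0 : 0 < d by apply: leq_ltn_trans (ltn_ord k).
  apply/card_gt0P; exists (Ordinal d_gt0).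
  by apply/has_path_ending_atP; exists k, [::].
by move=> r r_path; rewrite /ell => ->.
Qed.

(** Increasing positions are distinct, so r < d and r is among the lengths in the maximum. *)
Lemma has_path_leq_ell (pi : 'S_d) k r :
  has_path_ending_at e pi k r -> r <= ell e pi k.
Proof.
move=> r_path; have lt_rd : r < d.
  have /has_path_ending_atP[p [s [<- _ ps]]] := r_path.
  have : uniq (p :: s).
    apply: (@sorted_uniq _ (fun p q : 'I_d => p < q)) => [q1 q2 q3 | q | ].
    - exact: ltn_trans.
    - exact: ltnn.
    - by apply: sub_path ps => q1 q2 /andP[].
  by move/card_uniqP => /= <-; rewrite -[X in _ <= X]card_ord max_card.
exact: (@leq_bigmax_cond _ (fun r : 'I_d => has_path_ending_at e pi k r) val
          (Ordinal lt_rd)).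
Qed.

(** Append j to a longest path ending at i. *)
Lemma ltn_ell (pi : 'S_d) (i j : 'I_d) :
  i < j -> e (pi i) (pi j) -> ell e pi i < ell e pi j.
Proof.
move=> ij eij; apply: has_path_leq_ell.
have /has_path_ending_atP[p [s [sz s_last ps]]] := ell_attained pi i.
apply/has_path_ending_atP; exists p, (rcons s j).
by rewrite size_rcons sz last_rcons rcons_path ps s_last /position_rel /= ij.
Qed.

Lemma is_cutS (pi : 'S_d) (i j : 'I_d) : j = i.+1 :> nat ->
  is_cut e pi j = (ell e pi i < ell e pi j)
                  || (ell e pi i == ell e pi j) && (pi i < pi j).
Proof.
move=> ij; rewrite /is_cut ij /=; apply/existsP/idP => [[k] | cut_j].
  by rewrite eqSS => /andP[/eqP/val_inj ->].
by exists i; rewrite eqxx.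
Qed.

(** * Colorings compatible with a permutation *)

Section Coloring.

Variables (n : nat).
Implicit Types (phi : {ffun 'I_d -> 'I_n}) (pi : 'S_d).

Definition compatible phi pi : bool :=
  strict_at (is_cut e pi) [ffun i => phi (pi i)].

Lemma compatibleP phi pi :
  reflect (forall i j : 'I_d, j = i.+1 :> nat ->
             phi (pi i) <= phi (pi j) /\
             (is_cut e pi j -> phi (pi i) < phi (pi j)))
          (compatible phi pi).
Proof.
apply: (iffP forallP) => [c i j ij | c i].
  have /forallP/(_ j) := c i; rewrite ij eqxx !ffunE.
  by move=> /andP[-> /implyP].
apply/forallP => j; apply/implyP => /eqP ij; rewrite !ffunE.
by case: (c _ _ ij) => -> /implyP.
Qed.

(* The length of the longest path ending at v in the acyclic orientation of
   the graph along increasing colors. *)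
Definition color_depth phi (v : 'I_d) : nat :=
  \max_(r < d | [exists t : r.+1.-tuple 'I_d,
     (tnth t ord_max == v) &&
     sorted [rel x y | e x y && (phi x < phi y)] t]) r.

Definition monotone_on_edges phi pi : Prop :=
  forall i j : 'I_d, e (pi i) (pi j) -> (phi (pi i) < phi (pi j)) = (i < j).

(** Since [phi] and [pi] orient all edges alike, [pi] carries the paths along increasing positions
    bijectively onto the paths along increasing colors. *)
Lemma ell_color_depth phi pi k :
  monotone_on_edges phi pi -> ell e pi k = color_depth phi (pi k).
Proof.
move=> mono; apply: eq_bigl => r.
have sortedE (s : seq 'I_d) :
    sorted [rel x y | e x y && (phi x < phi y)] [seq pi p | p <- s] =
    sorted (fun p q : 'I_d => p < q) s && sorted e [seq pi p | p <- s].
  rewrite !sorted_map -sorted_relI; apply: eq_sorted => i j /=.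
  by rewrite andbC; case eij: (e _ _); rewrite ?andbF // mono.
apply/existsP/existsP => [[t] | [t /andP[t_last t_sorted]]].
  move=> /and3P[t_lt /eqP t_last t_e]; exists (map_tuple pi t).
  by rewrite tnth_map t_last eqxx sortedE t_lt t_e.
have tE : t = map_tuple pi (map_tuple pi^-1%g t).
  by apply: eq_from_tnth => i; rewrite !tnth_map permKV.
exists (map_tuple pi^-1%g t); rewrite tnth_map (eqP t_last) permK eqxx /=.
by rewrite -sortedE; move: t_sorted; rewrite {1}tE.
Qed.

(* Ties between colors are broken by decreasing (depth, label), which is exactly
   the absence of a cut between two consecutive vertices. *)
Definition color_order phi : rel 'I_d :=
  [rel u v | (phi u < phi v) || (phi u == phi v) &&
     ((color_depth phi v < color_depth phi u)
      || (color_depth phi v == color_depth phi u) && (v < u))].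

Lemma color_order_irr phi : irreflexive (color_order phi).
Proof. by move=> u; rewrite /color_order /= !ltnn !andbF. Qed.

Lemma color_order_trans phi : transitive (color_order phi).
Proof. by move=> v u w; rewrite /color_order /= -!val_eqE /=; lia. Qed.

Lemma color_order_total phi u v :
  u != v -> color_order phi u v || color_order phi v u.
Proof. by rewrite /color_order /= -!val_eqE /=; lia. Qed.

Lemma compatible_mono phi pi : compatible phi pi ->
  forall i j : 'I_d, i < j -> phi (pi i) <= phi (pi j)
                   /\ (e (pi i) (pi j) -> phi (pi i) < phi (pi j)).
Proof.
move=> /compatibleP c i j ij.
(* Between neighbours, the color rises or, without a cut, stays equal while [ell] does not increase.
   This lexicographic form is transitive, and an edge, which raises [ell], then forces the color to
   rise. *)
pose T := [rel i j | (phi (pi i) < phi (pi j)) ||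
   (phi (pi i) == phi (pi j)) && (ell e pi j <= ell e pi i)].
have : T i j.
  apply: (ord_consecutive (T := T)) ij => [k1 k2 k3 | k l kl] /=.
    by rewrite -!val_eqE /=; lia.
  by have := c _ _ kl; rewrite (is_cutS pi kl) -!val_eqE /=; lia.
rewrite /= -val_eqE /= => Tij; split; first by lia.
by move=> /(ltn_ell ij); lia.
Qed.

Lemma compatible_proper phi pi : compatible phi pi -> proper_coloring e phi.
Proof.
move=> /compatible_mono mono; apply/forallP => x; apply/forallP => y.
rewrite -[x](permKV pi) -[y](permKV pi); set i := _ x; set j := _ y.
apply/implyP => eij; rewrite -val_eqE /=.
case: (ltngtP i j) => [lt_ij | lt_ji | /val_inj E].
- by have [_ /(_ eij)] := mono _ _ lt_ij; lia.
- by rewrite e_sym in eij; have [_ /(_ eij)] := mono _ _ lt_ji; lia.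
- by rewrite E e_irr in eij.
Qed.

(** Either side makes the colors weakly increase along [pi], hence [ell] equals the color depth. A
    step without a cut is then exactly a tie broken by decreasing (depth, label). *)
Lemma compatible_color_order phi pi : proper_coloring e phi ->
  compatible phi pi =
  [forall i : 'I_d, forall j : 'I_d,
     (j == i.+1 :> nat) ==> color_order phi (pi i) (pi j)].
Proof.
move=> phi_proper.
(* Properness excludes equal colors on an edge, so weak monotonicity decides its orientation. *)
have edge_mono : (forall i j : 'I_d, i < j -> phi (pi i) <= phi (pi j)) ->
    monotone_on_edges phi pi.
  move=> mono i j eij.
  have /forallP/(_ (pi j))/implyP/(_ eij) := forallP phi_proper (pi i).
  rewrite -val_eqE /=; case: (ltngtP i j) => [/mono|/mono|/val_inj ->]; lia.
apply/idP/forallP => [c i | sorted_pi].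
  apply/forallP => j; apply/implyP => /eqP ij.
  have depthE k : color_depth phi (pi k) = ell e pi k.
    by rewrite (@ell_color_depth phi) //; apply: edge_mono => k1 k2;
       case/(compatible_mono c).
  have : pi i != pi j by apply/eqP => /perm_inj E; move: ij; rewrite E; lia.
  move/compatibleP/(_ _ _ ij): c.
  rewrite (is_cutS pi ij) /color_order /= !depthE -!val_eqE /=.
  by lia.
have next (i j : 'I_d) : j = i.+1 :> nat -> color_order phi (pi i) (pi j).
  by move=> ij; have /forallP/(_ j) := sorted_pi i; rewrite ij eqxx.
have depthE k : ell e pi k = color_depth phi (pi k).
  apply/ell_color_depth/edge_mono => i j ij.
  have : color_order phi (pi i) (pi j).
    apply: (ord_consecutive (T := [rel i j | color_order phi (pi i) (pi j)])) ij.
      by move=> ? ? ?; apply: color_order_trans.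
    exact: next.
  by rewrite /color_order /= -val_eqE /=; lia.
apply/compatibleP => i j ij; have := next _ _ ij.
rewrite (is_cutS pi ij) !depthE /color_order /= -!val_eqE /=; lia.
Qed.

Lemma card_compatible_perm phi :
  #|[set pi | compatible phi pi]| = proper_coloring e phi.
Proof.
have [phi_proper | not_proper] := boolP (proper_coloring e phi); last first.
  apply: eq_card0 => pi; rewrite inE.
  by apply/negP => /compatible_proper; apply/negP.
rewrite /= -(card_sorting_perm (@color_order_irr phi) (@color_order_trans phi)
              (@color_order_total phi)).
by apply: eq_card => pi; rewrite !inE compatible_color_order.
Qed.

Lemma num_cuts_le pi : num_cuts e pi <= d.
Proof. by rewrite -[X in _ <= X]card_ord max_card. Qed.

(** Composition with [pi] is a bijection from compatible colorings to the maps counted by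
    [card_strict_at]; the non-cuts are the places where equality is allowed. *)
Lemma card_compatible_coloring pi :
  #|[set phi | compatible phi pi]| = 'C(n + (d - num_cuts e pi), d).
Proof.
have -> : d - num_cuts e pi = #|[set k | ~~ is_cut e pi k]|.
  rewrite [RHS]cardsCs card_ord; congr (_ - _).
  by apply: eq_card => k; rewrite !inE negbK.
rewrite -card_strict_at => [|k k0]; last by rewrite /is_cut k0.
pose comp phi : {ffun 'I_d -> 'I_n} := [ffun i => phi (pi i)].
have comp_inj : injective comp.
  move=> f g /ffunP fg; apply/ffunP => x.
  by have := fg (pi^-1%g x); rewrite !ffunE permKV.
rewrite -(card_imset _ comp_inj); apply: eq_card => f; rewrite inE.
have -> : f = comp [ffun x => f (pi^-1%g x)].
  by apply/ffunP => i; rewrite !ffunE permK.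
by rewrite mem_imset // inE.
Qed.

(** Double counting of the compatible pairs ([phi], [pi]). *)
Lemma chi_sum_binomial : chi e n = \sum_pi 'C(n + (d - num_cuts e pi), d).
Proof.
rewrite /chi -sum1dep_card big_mkcond /=.
under eq_bigr => phi _.
  rewrite (_ : (if _ then 1 else 0) = nat_of_bool (proper_coloring e phi)) //.
  rewrite -card_compatible_perm -sum1dep_card big_mkcond.
over.
rewrite exchange_big; apply: eq_bigr => pi _.
by rewrite -card_compatible_coloring -sum1dep_card [RHS]big_mkcond.
Qed.

End Coloring.

(** * The numerator polynomial and its independence of the labeling *)

Lemma is_W_cut_poly : is_W e (cut_poly e).
Proof.
move=> k; rewrite [RHS]coef_sum.
rewrite -(eq_bigr _ (fun pi _ =>
            fps_mul_shifted_binomial int (num_cuts e pi) d k)).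
rewrite -fps_mul_suml; apply: eq_fps_mul => n.
rewrite /fps_chi chi_sum_binomial -natz natr_sum; apply: eq_bigr => pi _.
by rewrite natz binomial_shiftE ?num_cuts_le.
Qed.

End Graph.

Lemma is_W_unique d (e : rel 'I_d) W W' : is_W e W -> is_W e W' -> W = W'.
Proof. by move=> WP W'P; apply/polyP => k; have := WP k; rewrite W'P. Qed.

(** Composition with s maps the proper colorings for [e] bijectively onto those for
    [relabel s e]. *)
Lemma chi_relabel d (s : 'S_d) (e : rel 'I_d) : chi (relabel s e) =1 chi e.
Proof.
move=> n; pose comp (phi : {ffun 'I_d -> 'I_n}) := [ffun x => phi (s x)].
have comp_inj : injective comp.
  move=> f g /ffunP fg; apply/ffunP => x.
  by have := fg (s^-1%g x); rewrite !ffunE permKV.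
rewrite /chi -[RHS](card_imset _ comp_inj); apply: eq_card => f; rewrite inE.
have -> : f = comp [ffun x => f (s^-1%g x)].
  by apply/ffunP => i; rewrite !ffunE permK.
rewrite mem_imset // inE; set g := finfun _.
apply/forallP/forallP => gP x; apply/forallP => y.
  have /forallP/(_ (s^-1%g y)) := gP (s^-1%g x).
  by rewrite /relabel !ffunE !permKV.
by have /forallP/(_ (s y)) := gP (s x); rewrite /relabel !ffunE !permK.
Qed.

Theorem theorem1p6 (d : nat) (e : rel 'I_d)
    (e_sym : symmetric e) (e_irr : irreflexive e) :
  [/\ exists W : {poly int}, is_W e W,
      forall W : {poly int}, is_W e W -> W = cut_poly e
    & forall s : 'S_d, cut_poly (relabel s e) = cut_poly e].
Proof.
have cutW := is_W_cut_poly e_sym e_irr.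
split=> [|W WP|s]; first by exists (cut_poly e).
  exact: is_W_unique WP cutW.
have s_sym : symmetric (relabel s e) by move=> x y; apply: e_sym.
have s_irr : irreflexive (relabel s e) by move=> x; apply: e_irr.
(* Both graphs have the same series, so both cut polynomials are numerators for [e]. *)
apply: (@is_W_unique d e) => // k; rewrite -(is_W_cut_poly s_sym s_irr k).
by apply: eq_fps_mul => n; rewrite /fps_chi chi_relabel.
Qed.
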